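(* Let $k\ge 2$ be an integer. For every $n\ge 1$, the polynomial $a_n(t)=\sum_{T\in\mathcal A_n^k}t^{\,\mathrm{pv}(T)}$ is given by $$a_n(t)=t\,\prod_{i=1}^{n-1}\big((ki-i+1)\,t+k\,(n-i)\big).$$
   Context: All trees are labeled and rooted; $[n]=\{1,\dots,n\}$. A $k$-ary tree is a rooted tree in which each vertex has at most $k$ children and each child of a vertex is designated as its first, second, ..., or $k$th child (at most one child per position). $\mathcal A_n^k$ is the set of $k$-ary trees with vertex set $[n]$. A vertex $j$ is a descendant of $i$ if $i$ lies on the path from $j$ to the root (so $i$ is a descendant of itself). A vertex $i$ of $T$ is proper if $i$ is the smallest among all its descendants. $\mathrm{pv}(T)$ is the number of proper vertices of $T$. *)

(* Defs.v *)
From HB Require Import structures.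
From mathcomp Require Import all_boot all_order all_algebra.

Set Implicit Arguments.
Unset Strict Implicit.
Unset Printing Implicit Defensive.

(* The vertex set {1, ..., n} is represented by 'I_n through the
   order-preserving shift i |-> i + 1, and the child positions 1, ..., k by
   'I_k in the same way.  A k-ary tree is stored through its parent function:
   T v = Some (p, c) means that v is the child of p in position c, and
   T v = None that v has no parent. *)
Definition parent_fun (k n : nat) := {ffun 'I_n -> option ('I_n * 'I_k)}.

Definition parent_rel (k n : nat) (T : parent_fun k n) : rel 'I_n :=
  fun v p => if T v is Some (q, _) then q == p else false.

Definition is_root (k n : nat) (T : parent_fun k n) (v : 'I_n) : bool :=
  T v == None.

(* Some vertex r is the only root and is reached from every vertex by going
   from child to parent (this excludes cycles), and no two vertices occupy the
   same position under the same parent. *)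
Definition is_kary_tree (k n : nat) (T : parent_fun k n) : bool :=
  [exists r, [forall v, (is_root T v == (v == r)) &&
                        connect (parent_rel T) v r]]
  && [forall u, forall v, (~~ is_root T u && (T u == T v)) ==> (u == v)].

Definition kary_trees (k n : nat) : {set parent_fun k n} :=
  [set T | is_kary_tree T].

(* The path from j to the root is the chain of successive parents of j, so
   i lies on it exactly when i is reached from j along parent_rel. *)
Definition descendant (k n : nat) (T : parent_fun k n) (i j : 'I_n) : bool :=
  connect (parent_rel T) j i.

Definition proper_vertex (k n : nat) (T : parent_fun k n) (i : 'I_n) : bool :=
  [forall j, descendant T i j ==> (i <= j)].

Definition pv (k n : nat) (T : parent_fun k n) : nat :=
  #|[set i | proper_vertex T i]|.

Definition pv_poly (k n : nat) : {poly int} :=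
  (\sum_(T in kary_trees k n) 'X^(pv T))%R.

(* Main.v *)
Require Import Defs.
From HB Require Import structures.
From mathcomp Require Import all_boot all_order all_algebra.
From mathcomp Require Import zify.

Set Implicit Arguments.
Unset Strict Implicit.
Unset Printing Implicit Defensive.

Import Order.TTheory GRing.Theory Num.Theory.

Local Open Scope ring_scope.

(** The trees are generated by revealing the parents of the vertices one at a
    time, in the manner of a Pruefer code read backwards.  At each moment there
    is an anchored set S, all of whose vertices have known ancestry up to the
    root, and a chain u = c_1, ..., c_m = w, where c_(i+1) is the parent of c_i
    and u is the smallest vertex outside S.  The next step reveals the parent
    of w, with its position.  In a tree there are two possibilities.

    - The parent is in S (or w is the root, when S is empty).  A tree on i
      vertices has ki - (i - 1) free positions, and an empty tree has one
      possibility, so there are ki - i + 1 choices.  The chain joins S, and a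
      new chain starts from the smallest vertex left.
    - The parent is one of the n - i - m vertices not met so far, in any of the
      k positions, where i = |S|; the chain gets longer.

    When the chain joins S, exactly one of its vertices is proper: u is, because
    its descendants lie outside S, where u is minimal; the others are not,
    because they have the smaller descendant u.  So each closing step
    contributes a factor t.

    Put A_i = (ki - i + 1) t and B_j = k (n - j), and let F(i, m) be the
    generating function of the trees that complete such a state, counted by
    their proper vertices outside S.  Then, for i + m < n,

      F(i, m) = A_i F(i + m, 1) + B_(i+m) F(i, m + 1).

    The way in which the i + m vertices met so far are split between S and the
    chain enters only through the factor A_i, so by induction
    F(i, m) = A_i H(i + m), and substituting this form gives
    H(j) = (A_j + B_j) H(j + 1) with H(n) = 1.
    Hence a_n(t) = F(0, 1) = A_0 H(1), which is the product formula.

    The recursion is [exploration_sum].  It rests on [completion_value] (the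
    two possibilities above are exhaustive), [extend_exploration] and
    [close_exploration] (both choices lead to legitimate states), and
    [pv_outside_chain] (one proper vertex per chain). *)

(** * Trees as injective parent functions, parent-closed sets *)

Definition rooted (k n : nat) (T : parent_fun k n) (v : 'I_n) : bool :=
  [exists r, is_root T r && connect (parent_rel T) v r].

(** As the value None marks a root, injectivity of the parent function says at
    once that the root is unique and that no position is used twice.  The
    vertex v0 guarantees that there is a root at all. *)
Lemma kary_treeP (k n : nat) (T : parent_fun k n) (v0 : 'I_n) :
  reflect (injective T /\ forall v, rooted T v) (T \in kary_trees k n).
Proof.
rewrite inE; apply: (iffP andP) => [[/existsP[r /forallP hr] /forallP hinj]|].
  have rootE v : (T v == None) = (v == r) by have /andP[/eqP] := hr v.
  split=> [u v eq_uv|v].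
    have [/eqP ur|nroot] := boolP (is_root T u).
      have /eqP -> : u == r by rewrite -rootE ur.
      by apply/esym/eqP; rewrite -rootE -eq_uv ur.
    have /forallP /(_ v) := hinj u.
    by rewrite nroot eq_uv eqxx /= => /eqP.
  apply/existsP; exists r; rewrite /is_root rootE eqxx /=.
  by have /andP[] := hr v.
move=> [injT rootedT]; split; last first.
  apply/forallP=> u; apply/forallP=> v; apply/implyP => /andP[_ /eqP].
  by move/injT ->.
have /existsP[r /andP[/eqP rootr _]] := rootedT v0.
apply/existsP; exists r; apply/forallP=> v; apply/andP; split.
  rewrite /is_root; apply/eqP; apply/eqP/eqP => [rootv|->]; last exact: rootr.
  by apply: injT; rewrite rootv.
have /existsP[r' /andP[/eqP rootr']] := rootedT v.
by rewrite (injT r' r) // rootr' rootr.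
Qed.

(** The places to which a vertex can be attached when its parent has to be in
    S.  The value None is included because it is what the first vertex of a
    tree, its root, receives; injectivity makes it available only once. *)
Definition ports (k n : nat) (S : {set 'I_n}) : {set option ('I_n * 'I_k)} :=
  [set x | if x is Some (p, _) then p \in S else true].

Lemma card_ports (k n : nat) (S : {set 'I_n}) :
  #|ports k S| = (k * #|S| + 1)%N.
Proof.
have -> : ports k S = None |: [set Some x | x in setX S [set: 'I_k]].
  apply/setP=> -[[p c]|]; rewrite !inE //=.
  apply/idP/imsetP => [pS|[[q d]]]; first by exists (p, c); rewrite // !inE pS.
  by rewrite !inE andbT => qS [-> _].
rewrite cardsU1 card_imset; last by move=> x y [].
rewrite cardsX cardsT card_ord mulnC addnC; congr (_ + _)%N.
by case: imsetP => [[x _]|].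
Qed.

Lemma card_portsC (k n : nat) (S : {set 'I_n}) :
  #|~: ports k S| = (k * (n - #|S|))%N.
Proof.
have := cardsC (ports k S).
rewrite card_option card_prod !card_ord card_ports => h.
by rewrite mulnBr [in RHS]mulnC; lia.
Qed.

Lemma path_agree (k n : nat) (f T : parent_fun k n) (u : 'I_n) (s : seq 'I_n) :
  {in belast u s, T =1 f} -> path (parent_rel f) u s ->
  path (parent_rel T) u s.
Proof.
elim: s u => //= x s IHs u agree /andP[ux xs]; apply/andP; split.
  by rewrite /parent_rel agree ?mem_head.
by apply: IHs => // y ys; apply: agree; rewrite inE ys orbT.
Qed.

Lemma path_parent (k n : nat) (T : parent_fun k n) (u v : 'I_n)
    (s : seq 'I_n) :
  path (parent_rel T) u s -> v \in belast u s ->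
  exists p c, T v = Some (p, c) /\ p \in s.
Proof.
elim: s u => //= x s IHs u /andP[ux xs]; rewrite inE => /orP[/eqP ->|vb].
  move: ux; rewrite /parent_rel; case: (T u) => // -[p c] /eqP ->.
  by exists x, c; rewrite mem_head.
have [p [c [-> ps]]] := IHs x xs vb.
by exists p, c; rewrite inE ps orbT.
Qed.

Definition parent_closed (k n : nat) (T : parent_fun k n) (S : {set 'I_n}) :=
  {in S, forall v, T v \in ports k S}.

Lemma parent_closed_path (k n : nat) (T : parent_fun k n) (S : {set 'I_n})
    (v : 'I_n) (s : seq 'I_n) :
  parent_closed T S -> v \in S -> path (parent_rel T) v s ->
  {subset v :: s <= S}.
Proof.
move=> cl; elim: s v => /= [|x s IHs] v vS; first by move=> _ y; rewrite inE => /eqP ->.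
case/andP=> vx xs; have := cl v vS; move: vx; rewrite /parent_rel.
case: (T v) => // -[p c] /eqP ->; rewrite inE => xS y.
by rewrite inE => /orP[/eqP -> //|]; apply: IHs.
Qed.

Lemma parent_closed_connect (k n : nat) (T : parent_fun k n) (S : {set 'I_n})
    (v r : 'I_n) :
  parent_closed T S -> v \in S -> connect (parent_rel T) v r -> r \in S.
Proof.
move=> cl vS /connectP[s vs ->].
exact: (parent_closed_path cl vS vs) (mem_last _ _).
Qed.

Lemma rooted_agree (k n : nat) (f T : parent_fun k n) (S : {set 'I_n})
    (v : 'I_n) :
  parent_closed f S -> {in S, T =1 f} -> v \in S -> rooted f v -> rooted T v.
Proof.
move=> cl agree vS /existsP[r /andP[rootr /connectP[s vs rE]]].
have sS := parent_closed_path cl vS vs.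
apply/existsP; exists r; rewrite /is_root agree; last by rewrite rE sS ?mem_last.
apply/andP; split; first exact: rootr.
apply/connectP; exists s => //.
by apply: path_agree vs => x /mem_belast /sS /agree.
Qed.

(** * States of the exploration *)

Definition upd (k n : nat) (f : parent_fun k n) (w : 'I_n)
    (x : option ('I_n * 'I_k)) : parent_fun k n :=
  [ffun v => if v == w then x else f v].

Lemma upd_same k n (f : parent_fun k n) w x : upd f w x w = x.
Proof. by rewrite ffunE eqxx. Qed.

Lemma upd_other k n (f : parent_fun k n) w x v : v != w -> upd f w x v = f v.
Proof. by rewrite ffunE => /negbTE ->. Qed.

Definition completions (k n : nat) (f : parent_fun k n) (D : {set 'I_n}) :=
  [set T in kary_trees k n | [forall v in D, T v == f v]].

Definition chain (n : nat) (u : 'I_n) (s : seq 'I_n) : {set 'I_n} :=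
  [set v in u :: s].

(** The vertices whose parent is known: the last vertex of the chain is waiting
    for its own. *)
Definition decided (n : nat) (S : {set 'I_n}) (u : 'I_n) (s : seq 'I_n) :=
  S :|: [set v in belast u s].

Record anchored (k n : nat) (f : parent_fun k n) (S : {set 'I_n}) : Prop :=
  Anchored {
    anchored_closed : parent_closed f S;
    anchored_rooted : {in S, forall v, rooted f v} }.

(** The values of f outside [decided S u s] are irrelevant: f carries partial
    information about a tree. *)
Record exploration (k n : nat) (f : parent_fun k n) (S : {set 'I_n})
    (u : 'I_n) (s : seq 'I_n) : Prop := Exploration {
  expl_anchored : anchored f S;
  expl_inj : {in decided S u s &, injective f};
  expl_path : path (parent_rel f) u s;
  expl_uniq : uniq (u :: s);
  expl_out : {in u :: s, forall v, v \notin S};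
  expl_min : forall j, j \notin S -> (u <= j)%N }.

Lemma decidedU1 (n : nat) (S : {set 'I_n}) (u : 'I_n) (s : seq 'I_n) :
  last u s |: decided S u s = S :|: chain u s.
Proof.
apply/setP=> v; rewrite !inE -[_ || (v \in s)]in_cons lastI mem_rcons inE.
by rewrite orbCA.
Qed.

Lemma last_undecided k n (f : parent_fun k n) S u s :
  exploration f S u s -> last u s \notin decided S u s.
Proof.
case=> _ _ _ us out _; rewrite !inE negb_or out ?mem_last //=.
by move: us; rewrite lastI rcons_uniq => /andP[].
Qed.

Lemma card_explored k n (f : parent_fun k n) S u s :
  exploration f S u s -> #|S :|: chain u s| = (#|S| + (size s).+1)%N.
Proof.
case=> _ _ _ us out _; rewrite cardsU; have -> : S :&: chain u s = set0.
  apply/setP=> v; rewrite in_setI in_set0 [v \in chain _ _]inE.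
  by apply/andP => -[vS /out]; rewrite vS.
by rewrite cards0 subn0 cardsE (card_uniqP us).
Qed.

Lemma decided_ports k n (f : parent_fun k n) S u s :
  exploration f S u s -> {in decided S u s, forall v, f v \in ports k (S :|: chain u s)}.
Proof.
case=> -[cl _] _ us _ _ _ v; rewrite inE => /orP[/cl|].
  by rewrite !inE; case: (f v) => // -[p c] pS; rewrite inE pS.
rewrite inE => /(path_parent us)[p [c [-> ps]]].
by rewrite !inE ps !orbT.
Qed.

Lemma upd_inj k n (f : parent_fun k n) (D : {set 'I_n}) w x :
  {in D &, injective f} -> w \notin D -> x \notin f @: D ->
  {in w |: D &, injective (upd f w x)}.
Proof.
move=> inj wD xD a b; rewrite !inE.
have nw v : v \in D -> v != w by apply: contraTneq => ->.
move=> /orP[/eqP -> | aD] /orP[/eqP -> | bD] //.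
- rewrite upd_same upd_other ?nw // => xE.
  by case/negP: xD; rewrite xE imset_f.
- rewrite upd_same upd_other ?nw // => xE.
  by case/negP: xD; rewrite -xE imset_f.
by rewrite !upd_other ?nw //; apply: inj.
Qed.

(** The new parent p is not in the explored set, whereas all the revealed values
    point into it, so injectivity survives. *)
Lemma extend_exploration k n (f : parent_fun k n) S u s p (c : 'I_k) :
  exploration f S u s -> p \notin S :|: chain u s ->
  exploration (upd f (last u s) (Some (p, c))) S u (rcons s p).
Proof.
move=> E pout; have wD := last_undecided E; have dp := decided_ports E.
case: (E) => -[cl rt] inj us un out mi.
have agree : {in decided S u s, upd f (last u s) (Some (p, c)) =1 f}.
  by move=> v vD; rewrite upd_other //; apply: contraTneq vD => ->.
have agreeS : {in S, upd f (last u s) (Some (p, c)) =1 f}.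
  by move=> v vS; rewrite agree // inE vS.
have [pS pus] : p \notin S /\ p \notin u :: s.
  by move: pout; rewrite !inE !negb_or => /andP[-> ].
split=> //.
- split=> v vS; first by rewrite agreeS ?cl.
  exact: rooted_agree cl agreeS vS (rt v vS).
- have -> : decided S u (rcons s p) = last u s |: decided S u s.
    apply/setP=> v; rewrite !inE belast_rcons lastI.
    by rewrite mem_rcons inE orbCA.
  apply: upd_inj => //; apply/imsetP => -[v /dp pv pE].
  by move: pv; rewrite -pE inE (negbTE pout).
- rewrite rcons_path; apply/andP; split; last by rewrite /parent_rel upd_same.
  by apply: path_agree us => v vb; rewrite agree // !inE vb orbT.
- by rewrite -rcons_cons rcons_uniq pus un.
- by move=> v; rewrite -rcons_cons mem_rcons inE => /orP[/eqP ->|/out].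
Qed.

(** The chain becomes part of the anchored set: its vertices climb to the last
    one, and from there to a root through S.  The conclusion does not restart a
    chain, because no vertex may be left. *)
Lemma close_exploration k n (f : parent_fun k n) S u s x :
  exploration f S u s -> x \in ports k S :\: f @: S ->
  let g := upd f (last u s) x in
  anchored g (S :|: chain u s) /\ {in S :|: chain u s &, injective g}.
Proof.
move=> E; rewrite in_setD => /andP[xf xS] g.
have wD := last_undecided E; have dp := decided_ports E.
case: (E) => -[cl rt] inj us un out mi.
have agree : {in decided S u s, g =1 f}.
  by move=> v vD; rewrite /g upd_other //; apply: contraTneq vD => ->.
have agreeS : {in S, g =1 f} by move=> v vS; rewrite agree // inE vS.
have subP y : y \in ports k S -> y \in ports k (S :|: chain u s).
  by rewrite !inE; case: y => // -[p c] pS; rewrite inE pS.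
have rtS v : v \in S -> rooted g v.
  by move=> vS; apply: rooted_agree cl agreeS vS (rt v vS).
split; last first.
  (* The value x avoids f on S by assumption, and f on the chain because
     parents of chain vertices are in the chain, not in S. *)
  rewrite -decidedU1; apply: upd_inj => //; apply/imsetP => -[v].
  rewrite 2!inE => /orP[vS xE|vb xE]; first by rewrite xE imset_f in xf.
  have [p [c [fv ps]]] := path_parent us vb.
  by move: xS; rewrite xE fv inE (negbTE (out p _)) // inE ps orbT.
have gw : rooted g (last u s).
  have gx : g (last u s) = x by rewrite /g upd_same.
  case gE: (g (last u s)) => [[p c]|]; last first.
    by apply/existsP; exists (last u s); rewrite /is_root gE eqxx connect0.
  have pS : p \in S by move: xS; rewrite -gx gE inE.
  have /existsP[r /andP[rr pr]] := rtS p pS.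
  apply/existsP; exists r; rewrite rr /=; apply: connect_trans pr.
  by apply: connect1; rewrite /parent_rel gE eqxx.
split=> v.
  rewrite -decidedU1 in_setU1 => /orP[/eqP ->|vD]; last by rewrite agree // decidedU1 dp.
  by rewrite decidedU1 /g upd_same subP.
rewrite inE => /orP[/rtS //|]; rewrite inE => vs.
have /existsP[r /andP[rr wr]] := gw.
apply/existsP; exists r; rewrite rr /=; apply: connect_trans wr.
have us' : path (parent_rel g) u s.
  by apply: path_agree us => z zb; rewrite agree // !inE zb orbT.
case/splitPl: vs us' => s1 s2 vE; rewrite cat_path last_cat -vE => /andP[_ vs].
by apply/connectP; exists s2.
Qed.

Lemma completionsP k n (f T : parent_fun k n) (D : {set 'I_n}) :
  T \in completions f D -> T \in kary_trees k n /\ {in D, T =1 f}.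
Proof.
rewrite inE => /andP[-> /forall_inP agree]; split=> // v vD.
exact/eqP/agree.
Qed.

Lemma completions_upd k n (f : parent_fun k n) (D : {set 'I_n}) w x : w \notin D ->
  completions (upd f w x) (w |: D) = [set T in completions f D | T w == x].
Proof.
move=> wD; apply/setP=> T; rewrite !inE -andbA; congr (_ && _).
apply/forall_inP/andP => [h|[/forall_inP h Tw] v].
  split; last by have := h w; rewrite upd_same setU11; apply.
  apply/forall_inP=> v vD; have := h v; rewrite inE vD orbT upd_other; first exact.
  by apply: contraTneq vD => ->.
rewrite !inE => /orP[/eqP ->|vD]; first by rewrite upd_same.
by rewrite upd_other ?h //; apply: contraTneq vD => ->.
Qed.

(** In a tree extending f, the last vertex of the chain cannot take a place
    already used by S, and its parent cannot be in the chain, since the chain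
    would then be a cycle. *)
Lemma completion_value k n (f T : parent_fun k n) S u s :
  exploration f S u s -> T \in completions f (decided S u s) ->
  T (last u s) \in (ports k S :\: f @: S) :|: ~: ports k (S :|: chain u s).
Proof.
move=> E /completionsP[/(kary_treeP _ u)[injT rtT] agree].
have wD := last_undecided E; have dp := decided_ports E.
case: (E) => -[cl rt] inj us un out mi.
have wS := out _ (mem_last u s).
rewrite in_setU in_setC orbC -implybE; apply/implyP => wC.
have us' : path (parent_rel T) u s.
  by apply: path_agree us => z zb; rewrite agree // !inE zb orbT.
rewrite in_setD; apply/andP; split.
  apply/imsetP => -[v vS]; rewrite -agree ?inE ?vS // => /injT wv.
  by rewrite wv vS in wS.
apply: contraLR (rtT u) => wnS; apply/existsPn=> r; apply/negP=> /andP[/eqP rr ur].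
(* Otherwise every vertex of the chain has its parent in the chain, so that
   the path from u to the root never leaves the chain. *)
have stay : {in chain u s, forall v, T v \in ports k (chain u s) /\ T v != None}.
  move=> v; rewrite inE lastI mem_rcons inE => /orP[/eqP ->|vb].
    move: wC wnS; rewrite !inE; case: (T _) => // -[p c].
    by rewrite !inE => /orP[-> //|].
  by have [p [c [-> ps]]] := path_parent us' vb; rewrite !inE ps orbT.
have : r \in chain u s.
  apply: parent_closed_connect ur; first by move=> v /stay[].
  by rewrite !inE eqxx.
by case/stay => _; rewrite rr.
Qed.

(** * Proper vertices along a chain *)

Definition pv_outside (k n : nat) (T : parent_fun k n) (S : {set 'I_n}) : nat :=
  #|[set i | proper_vertex T i] :\: S|.

(** The only proper vertex of the chain is its bottom u: a descendant of u in S
    would force u into S, so that u is minimal among its descendants, and u is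
    a smaller descendant of each of the other vertices. *)
Lemma pv_outside_chain (k n : nat) (T : parent_fun k n) (S : {set 'I_n})
    (u : 'I_n) (s : seq 'I_n) :
  parent_closed T S -> path (parent_rel T) u s -> uniq (u :: s) ->
  {in u :: s, forall v, v \notin S} -> (forall j, j \notin S -> (u <= j)%N) ->
  pv_outside T S = (pv_outside T (S :|: chain u s)).+1.
Proof.
move=> cl us un out mi; rewrite /pv_outside.
have uS : u \notin S by rewrite out ?mem_head.
have uproper : proper_vertex T u.
  apply/forallP=> j; apply/implyP => ju; apply: mi; apply: contra uS => jS.
  exact: parent_closed_connect ju.
rewrite (cardsD1 u) !inE uproper uS /=; congr _.+1.
apply: eq_card => v; rewrite !inE negb_or -andbA.
have [->|vu] /= := eqVneq v u; first by rewrite andbF.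
have [vs|] //= := boolP (v \in s); rewrite andbF; apply/negbTE/negP.
move=> /andP[_ /forallP /(_ u) /implyP]; rewrite /descendant.
have uv : connect (parent_rel T) u v.
  have vus : v \in u :: s by rewrite inE vs orbT.
  case/splitPl: vus us => s1 s2 <-; rewrite cat_path => /andP[us1 _].
  by apply/connectP; exists s1.
move=> /(_ uv) vleu; case/negP: vu; rewrite -val_eqE eqn_leq vleu mi //.
by rewrite out // inE vs orbT.
Qed.

(** * Summation over explorations *)

(** Closing a chain: a choice among the free places of an anchored set of size
    i, and one proper vertex. *)
Definition anchor_weight (k i : nat) : {poly int} := 'X *+ (k * i + 1 - i).

Definition step_weight (k n i : nat) : {poly int} :=
  anchor_weight k i + (k * (n - i))%:R.

(** Only the first factor depends on how the explored vertices are shared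
    between S and the chain; the induction is on the number of unexplored
    vertices. *)
Lemma exploration_sum k n (f : parent_fun k n) S u s :
  exploration f S u s ->
  \sum_(T in completions f (decided S u s)) 'X^(pv_outside T S) =
  anchor_weight k #|S| * \prod_(#|S| + (size s).+1 <= i < n) step_weight k n i.
Proof.
have [m] := ubnP (n - (#|S| + (size s).+1))%N.
elim: m f S u s => // m IHm f S u s lt_m E.
have wD := last_undecided E; have cE := card_explored E.
set w := last u s; set j := (#|S| + (size s).+1)%N.
have le_jn : (j <= n)%N by rewrite /j -cE -[leqRHS]card_ord max_card.
pose F x : {poly int} :=
  \sum_(T in completions (upd f w x) (S :|: chain u s)) 'X^(pv_outside T S).
have -> : \sum_(T in completions f (decided S u s)) 'X^(pv_outside T S) = \sum_x F x.
  rewrite (partition_big (fun T : parent_fun k n => T w) predT) //=.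
  apply: eq_bigr => x _; rewrite /F -decidedU1 completions_upd //.
  by apply: eq_bigl => T; rewrite !inE.
(* P1: the chain joins S; P2: the chain gets longer. *)
pose P1 := ports k S :\: f @: S; pose P2 := ~: ports k (S :|: chain u s).
have F0 x : x \notin P1 :|: P2 -> F x = 0.
  move=> nx; rewrite /F -decidedU1 completions_upd // big1 // => T.
  rewrite inE => /andP[TC /eqP Tw]; case/negP: nx; rewrite -Tw.
  exact: completion_value E TC.
have P12 : [disjoint P1 & P2].
  rewrite disjoints_subset; apply/subsetP=> x; rewrite !inE negbK => /andP[_].
  by case: x => // -[p c]; rewrite !inE => ->.
rewrite (bigID (mem (P1 :|: P2))) /= [X in _ + X]big1 // addr0.
rewrite (eq_bigl [in [predU P1 & P2]]) => [|x]; last by rewrite !inE.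
rewrite bigU //=.
have cP2 : #|P2| = (k * (n - j))%N by rewrite card_portsC cE.
have cP1 : #|P1| = (k * #|S| + 1 - #|S|)%N.
  case: (E) => -[cl _] inj _ _ _ _.
  rewrite cardsD (setIidPr _); last first.
    by apply/subsetP=> _ /imsetP[v vS ->]; apply: cl.
  rewrite card_ports card_in_imset // => a b aS bS; apply: inj; rewrite inE ?aS ?bS //.
pose H i := \prod_(i <= l < n) step_weight k n l.
have FP2 x : x \in P2 -> F x = anchor_weight k #|S| * H j.+1.
  case: x => [[p c]|]; rewrite 2!inE // => pout.
  have E' := extend_exploration c E pout.
  rewrite /F; have -> : S :|: chain u s = decided S u (rcons s p).
    by apply/setP=> v; rewrite !inE belast_rcons inE.
  have lt_jn : (j < n)%N.
    rewrite /j -cE -[ltnRHS]card_ord -cardsT proper_card //.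
    by rewrite properT; apply: contraNneq pout => ->; rewrite inE.
  rewrite IHm // size_rcons addnS //.
  by move: lt_m lt_jn; rewrite /j; lia.
have FP1 x : x \in P1 -> F x = 'X * (if j == n then 1 else anchor_weight k j * H j.+1).
  move=> xP1; have [an inj] := close_exploration E xP1.
  case: (E) => -[cl _] _ us un out mi.
  have agree T : T \in completions (upd f w x) (S :|: chain u s) ->
      {in decided S u s, T =1 f}.
    move=> /completionsP[_ aT] v vD; rewrite aT; last first.
      by rewrite -decidedU1 in_setU1 vD orbT.
    by rewrite upd_other //; apply: contraTneq vD => ->.
  rewrite /F (eq_bigr (fun T => 'X * 'X^(pv_outside T (S :|: chain u s)))); last first.
    move=> T /agree aT; rewrite (@pv_outside_chain _ _ _ _ u s) ?exprS //.
      by move=> v vS; rewrite aT ?cl // inE vS.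
    by apply: path_agree us => v vb; rewrite aT // !inE vb orbT.
  rewrite -mulr_sumr; congr (_ * _).
  have [jn|njn] := eqVneq j n.
    (* Everything is decided, so there is a single completion. *)
    have full : S :|: chain u s = setT.
      by apply/eqP; rewrite eqEcard subsetT cardsT card_ord cE -/j jn leqnn.
    rewrite full in an inj *; have -> : completions (upd f w x) setT = [set upd f w x].
      apply/setP=> T; rewrite in_set1; apply/idP/eqP => [/completionsP[_ aT]|->].
        by apply/ffunP=> v; apply: aT; rewrite inE.
      rewrite inE; apply/andP; split; last by apply/forall_inP.
      apply/(kary_treeP _ u); split=> [a b|v]; first by apply: inj; rewrite inE.
      by apply: (anchored_rooted an); rewrite inE.
    by rewrite big_set1 /pv_outside setDT cards0 expr0.
  have lt_jn : (j < n)%N by rewrite ltn_neqAle njn.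
  have [v0 v0out] : exists v, v \notin S :|: chain u s.
    apply/existsP; rewrite -negb_forall; apply: contraTN lt_jn => /forallP full.
    rewrite -leqNgt /j -cE -[leqLHS]card_ord -cardsT subset_leq_card //.
    by apply/subsetP=> v _; apply: full.
  have [u' u'out u'min] := @arg_minnP _ v0 (fun v => v \notin S :|: chain u s) val v0out.
  have dE : decided (S :|: chain u s) u' [::] = S :|: chain u s.
    by apply/setP=> v; rewrite !inE orbF.
  have E' : exploration (upd f w x) (S :|: chain u s) u' [::].
    by split; rewrite ?dE // => v; rewrite inE => /eqP ->.
  have := IHm _ _ _ _ _ E'; rewrite dE cE -/j addn1 => -> //.
  by move: lt_m lt_jn; rewrite /j /=; lia.
rewrite (eq_bigr _ FP1) (eq_bigr _ FP2) !sumr_const cP1 cP2.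
rewrite -/(H j) -mulrnAl -/(anchor_weight k #|S|) -mulr_natr -mulrA -mulrDr.
congr (_ * _).
have [jn|njn] := eqVneq j n.
  by rewrite jn subnn muln0 mulr0 addr0 /H big_geq.
rewrite /H [in RHS]big_ltn; last by rewrite ltn_neqAle njn.
by rewrite /step_weight mulrDl [_ * (_%:R)]mulrC.
Qed.

Theorem theorem6 (k : nat) (hk : (2 <= k)%N) (n : nat) (hn : (1 <= n)%N) :
  pv_poly k n =
  'X * \prod_(1 <= i < n)
         ((k%:Z * i%:Z - i%:Z + 1) *: 'X + (k%:Z * (n%:Z - i%:Z))%:P).
Proof.
(* Nothing is known yet, and the first chain starts from the smallest label. *)
pose u : 'I_n := Ordinal hn; pose f : parent_fun k n := [ffun=> None].
have dE : decided set0 u [::] = set0 by apply/setP=> v; rewrite !inE.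
have E : exploration f set0 u [::].
  split=> //; first by split=> v; rewrite inE.
  - by rewrite dE => v; rewrite inE.
  - by move=> v _; rewrite inE.
have := exploration_sum E; rewrite dE cards0 add0n /anchor_weight muln0 => sumE.
rewrite /pv_poly; transitivity (\sum_(T in completions f set0)
    'X^(pv_outside T set0) : {poly int}).
  apply: eq_big => [T|T _]; last by rewrite /pv_outside setD0.
  by rewrite [in RHS]inE; case: forall_inP; rewrite ?andbT // => -[v]; rewrite inE.
rewrite sumE mulr1n; congr (_ * _); apply: eq_big_nat => i /andP[_ lt_in].
rewrite /step_weight /anchor_weight; congr (_ + _).
  rewrite -scaler_nat; congr (_ *: _); rewrite natz; nia.
by rewrite -polyC_natr; congr _%:P; rewrite natz; nia.
Qed.
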